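(* Let $p$ be a prime. If $G$ is an Isaacs group of degree $p^2$ with $G$ $p$-closed, then the normal Sylow $p$-subgroup $K$ of $G$ is a $p$-group of order $p^6$ with $Z(K)$ elementary abelian of order $p^2$ and either: (1) $K' = Z(K)$, so that $K$ is semi-extraspecial; or (2) $Z(K) = [K',K] < K' < Z_2(K)$, where $Z_2(K)$ has order $p^4$ and $K'$ has order $p^3$.
   Context: All groups are finite. For an integer $e > 1$, a group $G$ is an Isaacs group of degree $e$ if $|G| = e^4 - e^3$ and $d = e^2 - e$ is the degree of some irreducible complex character of $G$ (so that $|G| = d(d+e)$). A group is $p$-closed if it has a normal Sylow $p$-subgroup. $K'$ is the derived subgroup of $K$, and $Z_2(K)$ is the second center, i.e. $Z_2(K)/Z(K) = Z(K/Z(K))$. A $p$-group $P$ is semi-extraspecial if $P/M$ is extraspecial for every maximal subgroup $M$ of $Z(P)$. *)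

(* Defs.v *)
From mathcomp Require Import all_boot all_order all_fingroup all_algebra.
From mathcomp Require Import all_solvable all_field all_character.

Set Implicit Arguments.
Unset Strict Implicit.
Unset Printing Implicit Defensive.

Import GroupScope.

Section Definitions.

Variable gT : finGroupType.
Implicit Types G P : {group gT}.

(* Complex irreducible characters are MathComp's 'chi_i, with values in the
   algebraic numbers algC. For e > 1 the truncated subtractions are exact. *)
Definition isaacs_group (e : nat) G : Prop :=
  [/\ (1 < e)%N,
      #|G| = (e ^ 4 - e ^ 3)%N
    & exists i : Iirr G, ('chi_i 1%g = (e ^ 2 - e)%N%:R)%R].

Definition p_closed (p : nat) G : Prop :=
  exists2 P : {group gT}, p.-Sylow(G) P & P <| G.

Definition semi_extraspecial (p : nat) P : Prop :=
  p.-group P /\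
  forall M : {group gT}, maximal M 'Z(P) -> extraspecial (P / M).

End Definitions.

(* Main.v *)
Require Import Defs.
From mathcomp Require Import all_boot all_order all_fingroup all_algebra.
From mathcomp Require Import all_solvable all_field all_character.

Import GroupScope.

(** An irreducible character of [G] of degree [p^2(p^2-1)] restricts to the
    normal Sylow subgroup [K], of order [p^6], as the sum of one [G]-orbit of
    [p^2-1] irreducible characters of degree [p^2]; the squared degrees of the
    remaining irreducible characters of [K] add up to [p^4]. A normal subgroup
    [M <> 1] of [G] inside [K] is in the kernel of none of the orbit, whence
    [#|K : M| <= p^4]. On the other hand a degree [p^2] forces
    [#|K : 'Z(K)| >= p^4], so ['Z(K)] is a minimal normal subgroup of [G] of
    order [p^2]. Moreover the orbit characters vanish off ['Z(K)] while all
    others have ['Z(K)] in their kernel, so by column orthogonality every coset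
    [x 'Z(K)] with [x] outside ['Z(K)] lies in the class of [x].

    If [K^`(1) <> 'Z(K)], then [Q := K / 'Z(K)] is nonabelian of order [p^4].
    Were it of maximal class, [ [~: 'Z_2(K), C] ] would be a characteristic
    subgroup of order [p], where [C / 'Z(K)] is the centraliser of [Q^`(1)]. *)

(** * Commutators with a fixed element, and nonabelian groups of order [p ^ 4] *)

(** When every [[~ x, h]] centralises [H], the expansion of [[~ x, h * g]] loses its triple
    commutator, so [h |-> [~ x, h]] is multiplicative up to the order of the factors. *)
Lemma comm1_group_set (gT : finGroupType) (x : gT) (H : {group gT}) :
  {in H, forall h, [~ x, h] \in 'C(H)} ->
  group_set [set [~ x, h] | h in H].
Proof.
move=> cHx; apply/group_setP; split.
  by apply/imsetP; exists 1; rewrite ?group1 ?commg1.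
move=> _ _ /imsetP[g Hg ->] /imsetP[h Hh ->]; apply/imsetP.
exists (h * g); first exact: groupM.
suffices /commgP/eqP cgh: commute [~ x, h] g by rewrite commgMR cgh mulg1.
exact: (centP (cHx h Hh)).
Qed.

(** As [[~ x, h]] is [x^-1 * x ^ h], the set is a translate of the class [x ^: H]. *)
Lemma card_comm1 (gT : finGroupType) (x : gT) (H : {group gT}) :
  #|[set [~ x, h] | h in H]| = #|H : 'C_H[x]|.
Proof.
by rewrite index_cent1 -(card_lcoset (x ^: H) x^-1) -lcosetE /lcoset -imset_comp.
Qed.

Lemma index_p2_between (gT : finGroupType) (p : nat) (A B C : {group gT}) :
  prime p -> #|C : A| = (p ^ 2)%N -> A \proper B -> B \proper C ->
  #|B : A| = p /\ #|C : B| = p.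
Proof.
move=> p_pr oCA /andP[sAB nsBA] /andP[sBC nsCB].
have dQ := Lagrange_index sBC sAB; rewrite oCA in dQ.
have p_gt0 := prime_gt0 p_pr.
have: #|B : A| %| p ^ 2 by rewrite -dQ; apply: dvdn_mull.
have: #|C : B| %| p ^ 2 by rewrite -dQ; apply: dvdn_mulr.
rewrite -indexg_eq1 in nsBA; rewrite -indexg_eq1 in nsCB.
case/(dvdn_pfactor _ _ p_pr) => m _ o1; case/(dvdn_pfactor _ _ p_pr) => n _ o2.
move: nsBA nsCB dQ; rewrite o1 o2 -expnD => nm nn /eqP.
rewrite eqn_exp2l ?prime_gt1 // => /eqP mn2.
move: m n {o1 o2} nm nn mn2 => [|m] [|n]; rewrite ?expn0 ?eqxx // => _ _.
by rewrite addnS addSn; move: m n => [|m] [|n].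
Qed.

(** For a noncentral [y], the central elements [[~ y, h]] form a subgroup [I] of order [#|Q :
    'C_Q[y]|]. This index is [p], since ['C_Q[y]] lies strictly between ['Z(Q)] and [Q]. As [Q / I]
    turns out to be abelian, [I] is the whole derived subgroup. *)
Lemma der1_center_index_p2 (gT : finGroupType) (p : nat) (Q : {group gT}) :
  prime p -> p.-group Q -> #|Q : 'Z(Q)| = (p ^ 2)%N -> #|Q^`(1)| = p.
Proof.
move=> p_pr pQ oQZ.
have sZQ := center_sub Q; have p_gt0 := prime_gt0 p_pr.
have nZQ : Q \subset 'N('Z(Q)) by exact: gFnorm.
have sQ'Z : Q^`(1) \subset 'Z(Q).
  apply: der1_min => //; apply: (@p2group_abelian _ p); first exact: quotient_pgroup.
  by rewrite card_quotient // oQZ pfactorK.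
have ncQ : ~~ abelian Q.
  apply/negP => /center_idP defZ; move: oQZ; rewrite defZ indexgg.
  by move/eqP; rewrite eq_sym -(expn0 p) eqn_exp2l ?prime_gt1.
have [y Qy notZy] : exists2 y, y \in Q & y \notin 'Z(Q).
  by apply/subsetPn; apply: contra ncQ => sQZ; apply: abelianS sQZ (center_abelian Q).
have cIQ : {in Q, forall h, [~ y, h] \in 'C(Q)}.
  move=> h Qh; have: [~ y, h] \in 'Z(Q) by rewrite (subsetP sQ'Z) ?mem_commg.
  by case/setIP.
pose I := Group (comm1_group_set _ y Q cIQ).
have sIZ : I \subset 'Z(Q).
  by apply/subsetP => _ /imsetP[h Qh ->]; rewrite (subsetP sQ'Z) ?mem_commg.
have [_ oQC] : #|'C_Q[y] : 'Z(Q)| = p /\ #|Q : 'C_Q[y]| = p.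
  apply: index_p2_between => //; apply/andP; split.
  - apply/subsetP => z /setIP[Qz cQz]; rewrite inE Qz.
    by apply/cent1P/(centP cQz).
  - by apply: contra notZy => /subsetP->; rewrite // inE Qy cent1id.
  - exact: subsetIl.
  rewrite subsetI subxx; apply: contra notZy => /subsetP cyQ.
  rewrite inE Qy; apply/centP => z Qz; apply/commute_sym/cent1P; exact: cyQ.
have oI : #|I| = p by rewrite -oQC -card_comm1.
have nIQ : Q \subset 'N(I).
  by rewrite cents_norm // centsC (subset_trans sIZ) ?subsetIr.
have cQI : abelian (Q / I).
  (* The preimage [W] of the centre of [Q / I] contains ['Z(Q)] and also [y], so its index in [Q] is
     1 or [p]; hence [Q / I] is cyclic modulo its centre. *)
  pose W := coset I @*^-1 'Z(Q / I); have sWQ : W \subset Q.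
    by rewrite sub_cosetpre_quo ?center_sub // /normal nIQ (subset_trans sIZ).
  have sZW : 'Z(Q) \subset W.
    rewrite -sub_quotient_pre ?(subset_trans sZQ) // subsetI quotientS //.
    by rewrite quotient_cents // subsetIr.
  have Wy : y \in W.
    rewrite mem_morphpre ?(subsetP nIQ) // inE mem_quotient //.
    apply/centP => _ /morphimP[z nIz Qz ->]; apply/commgP.
    rewrite -morphR ?(subsetP nIQ) //=; apply/eqP/coset_id.
    by apply/imsetP; exists z.
  have [defW | ltWQ] := eqVproper sWQ.
    by apply/center_idP; rewrite -['Z(_)]cosetpreK -/W defW.
  have [_ oQW] : #|W : 'Z(Q)| = p /\ #|Q : W| = p.
    apply: index_p2_between; rewrite // /proper sZW.
    by apply: contra notZy => /subsetP->.
  apply/cyclic_center_factor_abelian/prime_cyclic.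
  have: #|Q / I : W / I| = p.
    by rewrite index_quotient_eq // (subset_trans (subsetIr _ _)) ?(subset_trans sIZ).
  by rewrite cosetpreK card_quotient ?gFnorm // => ->.
apply/eqP; rewrite eqn_leq; apply/andP; split.
  by rewrite -oI subset_leq_card ?der1_min.
rewrite -oI subset_leq_card //; apply/subsetP => _ /imsetP[h Qh ->].
exact: mem_commg.
Qed.

(** Commutators are central of exponent dividing [p], so [[~ x ^+ p, y] = [~ x, y] ^+ p = 1]: all
    [p]-th powers are central and the Frattini subgroup is the centre. *)
Lemma pgroup_special (gT : finGroupType) (p : nat) (P : {group gT}) :
  prime p -> p.-group P -> P^`(1) = 'Z(P) -> p.-abelem 'Z(P) -> special P.
Proof.
move=> p_pr pP defZ abZ; split=> //; rewrite (Phi_joing pP) defZ.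
apply/joing_idPl; rewrite (MhoE 1 pP) gen_subG; apply/subsetP => _ /imsetP[x Px ->].
rewrite inE groupX //; apply/centP => y Py; apply/commgP.
have Zxy : [~ x, y] \in 'Z(P) by rewrite -defZ mem_commg.
have [_ cxy] := setIP Zxy.
rewrite expn1 commXg; last exact/commute_sym/(centP cxy).
by have /(abelemP p_pr)[_ ->] := abZ.
Qed.

Lemma joing_cycle_prime_index (gT : finGroupType) (A B : {group gT}) (x : gT) :
  A \subset B -> prime #|B : A| -> x \in B -> x \notin A -> A <*> <[x]> = B.
Proof.
move=> sAB prBA Bx notAx.
have maxA : maximal_eq A B by rewrite /maximal_eq orbC (p_index_maximal sAB).
have [_ /(_ (A <*> <[x]>)%G) maxAx] := maximal_eqP _ _ maxA.
have sAxB : A <*> <[x]> \subset B by rewrite join_subG sAB cycle_subG.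
case: (maxAx (joing_subl _ _) sAxB) => //= defA.
by case/negP: notAx; rewrite -defA -cycle_subG joing_subr.
Qed.

(** Neither the quotient by the centre nor the abelianisation can be cyclic, so the centre and the
    derived subgroup have order [p] or [p ^ 2]. The first alternative is class two, the second
    maximal class. *)
Lemma p4group_nonabelian (gT : finGroupType) (p : nat) (Q : {group gT}) :
  prime p -> #|Q| = (p ^ 4)%N -> ~~ abelian Q ->
  #|'Z(Q)| = (p ^ 2)%N /\ #|Q^`(1)| = p
  \/ [/\ #|'Z(Q)| = p, #|Q^`(1)| = (p ^ 2)%N & #|Q : 'C_Q(Q^`(1))| = p].
Proof.
move=> p_pr oQ ncQ; have p_gt1 := prime_gt1 p_pr; have p_gt0 := prime_gt0 p_pr.
have pQ : p.-group Q by rewrite /pgroup oQ pnatX pnat_id.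
have pow (H : {group gT}) : H \subset Q -> exists2 k, k <= 4 & #|H| = (p ^ k)%N.
  by move/cardSg; rewrite oQ => /(dvdn_pfactor _ _ p_pr).
have idx (H : {group gT}) k : H \subset Q -> #|H| = (p ^ k)%N -> k <= 4 ->
    #|Q : H| = (p ^ (4 - k))%N.
  by move=> sHQ oH k4; rewrite -divgS // oQ oH expnB.
have sZQ := center_sub Q; have sQ'Q := der_sub 1 Q.
have nilQ := pgroup_nil pQ.
have cyc (H : {group gT}) : Q \subset 'N(H) -> #|Q : H| %| p -> cyclic (Q / H).
  by move=> nHQ dv; apply: (dvdn_prime_cyclic p_pr); rewrite card_quotient.
have [k k4 oZ] := pow _ sZQ; have iZ := idx _ _ sZQ oZ k4.
have [j j4 oD] := pow _ sQ'Q; have iD := idx _ _ sQ'Q oD j4.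
have k_gt0 : 0 < k.
  rewrite lt0n; apply: contra ncQ => /eqP k0; have /eqP := oZ.
  by rewrite k0 -trivg_card1 center_nil_eq1 // => /eqP ->; apply: abelian1.
have k_lt3 : k < 3.
  rewrite ltnNge; apply: contra ncQ => k3.
  apply/cyclic_center_factor_abelian/cyc; rewrite ?gFnorm // iZ.
  by move: k k3 k4 {oZ iZ k_gt0} => [|[|[|[|[|]]]]].
have j_gt0 : 0 < j.
  rewrite lt0n; apply: contra ncQ => /eqP j0; have /eqP := oD.
  by rewrite j0 -trivg_card1 => /eqP/derG1P.
have j_lt3 : j < 3.
  rewrite ltnNge; apply: contra ncQ => j3.
  apply/cyclic_abelian/cyclic_nilpotent_quo_der1_cyclic/cyc; rewrite ?gFnorm // iD.
  by move: j j3 j4 {oD iD j_gt0} => [|[|[|[|[|]]]]].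
have [k2 | k1] : k = 2%N \/ k = 1%N.
  by move: k k_gt0 k_lt3 {k4 oZ iZ} => [|[|[|]]] //; [right | left].
  by left; rewrite oZ k2; split=> //; apply: der1_center_index_p2; rewrite ?iZ ?k2.
rewrite {}k1 expn1 {k k4 k_gt0 k_lt3} in oZ iZ.
have ntD : Q^`(1) != 1 by apply: contra ncQ => /eqP/derG1P.
(* The nontrivial normal derived subgroup of a nilpotent group meets the centre, here of prime
   order. *)
have sZD : 'Z(Q) \subset Q^`(1).
  by rewrite prime_meetG ?oZ // setIC meet_center_nil ?der_normal.
right; have [j1 | j2] : j = 1%N \/ j = 2%N.
  by move: j j_gt0 j_lt3 {j4 oD iD} => [|[|[|]]] //; [left | right].
  (* This case would make [Q] extraspecial, whose order is an odd power of [p]. *)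
  rewrite {}j1 expn1 in oD.
  have defD : Q^`(1) = 'Z(Q) by apply/esym/eqP; rewrite eqEcard sZD oD oZ /=.
  have esQ : extraspecial Q.
    split; last by rewrite oZ.
    by apply: (pgroup_special _ p) => //; rewrite prime_abelem.
  have [n _ /eqP] := card_extraspecial pQ esQ.
  by rewrite oQ eqn_exp2l // => /eqP /(congr1 odd); rewrite /= odd_double.
rewrite {}j2 in oD {j4 j_gt0 j_lt3 iD}; split=> //.
have ltZD : 'Z(Q) \proper Q^`(1).
  by rewrite properEcard sZD oZ oD (ltn_exp2l 1%N 2%N).
have [_ [u Du notZu]] := properP ltZD.
have Qu := subsetP sQ'Q u Du.
have ltDQ : [~: Q^`(1), Q] \proper Q^`(1).
  by rewrite (nil_comm_properl nilQ) // subsetI subxx gFnorm.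
(* The translated class of [u] lies in a proper subgroup of the derived subgroup, which has order
   [p ^ 2]. *)
have le_i : #|Q : 'C_Q[u]| <= p.
  have le_c : #|[~: Q^`(1), Q]| <= p.
    have := proper_card ltDQ; have := cardSg (proper_sub ltDQ); rewrite oD.
    case/(dvdn_pfactor _ _ p_pr) => m _ ->; rewrite ltn_exp2l // => m2.
    by rewrite -[leqRHS]expn1 leq_exp2l.
  rewrite -card_comm1 (leq_trans _ le_c) // subset_leq_card //.
  by apply/subsetP => _ /imsetP[q Qq ->]; apply: mem_commg.
(* Modulo the centre, [u] generates the derived subgroup, so centralising [u] suffices. *)
have sCC : 'C_Q[u] \subset 'C_Q(Q^`(1)).
  rewrite subsetI subsetIl centsC.
  have iDZ : #|Q^`(1) : 'Z(Q)| = p by rewrite -divgS // oD oZ expnS expn1 mulnK.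
  rewrite -(joing_cycle_prime_index _ _ _ _ sZD _ Du notZu) ?iDZ //.
  rewrite /= join_subG cycle_subG; apply/andP; split.
    by rewrite centsC (subset_trans (subsetIl _ _)) // centsC subsetIr.
  by apply/centP => c /setIP[_ /cent1P].
have: #|Q : 'C_Q(Q^`(1))| %| p ^ 4 by rewrite -oQ dvdn_indexg.
case/(dvdn_pfactor _ _ p_pr) => m _ om.
have: #|Q : 'C_Q(Q^`(1))| <= p.
  by apply: leq_trans le_i; rewrite dvdn_leq // indexgS.
have: #|Q : 'C_Q(Q^`(1))| != 1%N.
  rewrite indexg_eq1 subsetI subxx /= centsC; apply/negP => cDQ.
  by have /andP[_ /negP[]] := ltZD; rewrite subsetI sQ'Q.
rewrite om; move: m {om} => [|[|m]]; rewrite ?expn0 ?expn1 // -[X in _ <= X]expn1.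
by rewrite leq_exp2l.
Qed.

(** * The second centre, and the case of maximal class modulo the centre *)

Lemma card_ucn2 (gT : finGroupType) (K : {group gT}) :
  #|'Z_2(K)| = (#|'Z(K)| * #|'Z(K / 'Z(K))|)%N.
Proof. by rewrite ucnSn ucn1 card_cosetpre. Qed.

(** Three subgroups lemma, from [[~: 'Z_2(K), K, K] = 1]. *)
Lemma der1_cent_ucn2 (gT : finGroupType) (K : {group gT}) :
  K^`(1) \subset 'C('Z_2(K)).
Proof.
have Z2KK : [~: 'Z_2(K), K, K] = 1.
  by apply/commG1P; rewrite (subset_trans (ucn_comm 1 K)) // ucn1 subsetIr.
by apply/commG1P; rewrite three_subgroup // (commGC K).
Qed.

(* The last three hypotheses hold exactly when [K / 'Z(K)] has maximal class;
   the subgroup is [ [~: 'Z_2(K), C] ], C being the preimage of the centraliser.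
   If [x] generates ['Z_2(K)] modulo ['Z(K)], then [k |-> [~ x, k]] has kernel
   [K^`(1)], of index [p] in [C]. *)
Lemma camina_max_class_char (gT : finGroupType) (p : nat) (K : {group gT}) :
    prime p -> p.-group K -> #|'Z(K)| = (p ^ 2)%N -> #|K : 'Z(K)| = (p ^ 4)%N ->
    {in K :\: 'Z(K), forall x, 'Z(K) \subset [set [~ x, k] | k in K]} ->
    #|'Z(K / 'Z(K))| = p -> #|(K / 'Z(K))^`(1)| = (p ^ 2)%N ->
    #|K / 'Z(K) : 'C_(K / 'Z(K))((K / 'Z(K))^`(1))| = p ->
  exists2 M : {group gT}, M \char K & #|M| = p.
Proof.
move=> p_pr pK oZ iZ camK oZQ oDQ iC; have p_gt0 := prime_gt0 p_pr.
set Z := 'Z(K) in oZ iZ camK oZQ oDQ iC; have sZK : Z \subset K := center_sub K.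
have nZK : K \subset 'N(Z) by exact: gFnorm.
set C := (coset Z @*^-1 'C_(K / Z)((K / Z)^`(1)))%G.
have sZ2K : 'Z_2(K) \subset K := ucn_sub 2 K.
have sZZ2 : Z \subset 'Z_2(K) by rewrite /Z -ucn1 ucn_sub_geq.
have i2 : #|'Z_2(K) : Z| = p.
  by rewrite -divgS // card_ucn2 oZQ mulKn // cardG_gt0.
have /properP[_ [x Z2x notZx]] : Z \proper 'Z_2(K).
  by rewrite properEcard sZZ2 card_ucn2 oZQ ltn_Pmulr ?prime_gt1 ?cardG_gt0.
have Kx := subsetP sZ2K x Z2x.
have sxKZ : [set [~ x, k] | k in K] \subset Z.
  apply/subsetP => _ /imsetP[k Kk ->].
  have := subsetP (ucn_comm 1 K) [~ x, k]; rewrite ucn1; apply; exact: mem_commg.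
have defxK : [set [~ x, k] | k in K] = Z.
  by apply/eqP; rewrite eqEsubset sxKZ camK // inE notZx.
have sZD : Z \subset K^`(1).
  by rewrite -defxK; apply/subsetP => _ /imsetP[k Kk ->]; rewrite mem_commg.
have sDK := der_sub 1 K.
have oD : #|K^`(1)| = (p ^ 4)%N.
  rewrite -(Lagrange sZD) oZ -card_quotient ?(subset_trans sDK) //.
  by rewrite quotient_der //= oDQ -expnD.
have oK : #|K| = (p ^ 6)%N by rewrite -(Lagrange sZK) oZ iZ -expnD.
(* The derived subgroup has order [p ^ 4] and centralises [x]; the class of [x] has
   [#|'Z(K)| = p ^ 2] elements in a group of order [p ^ 6]. *)
have defCx : 'C_K[x] = K^`(1).
  apply/esym/eqP; rewrite eqEcard; apply/andP; split.
    rewrite subsetI sDK; apply/subsetP => d Dd; apply/cent1P.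
    by apply: (centP (subsetP (der1_cent_ucn2 _ K) d Dd)).
  have := Lagrange (subsetIl K 'C[x]); rewrite -card_comm1 defxK oZ oK oD => e6.
  by rewrite -(@leq_pmul2r (p ^ 2)) ?expn_gt0 ?p_gt0 // e6 -expnD.
have sCK : C \subset K.
  by rewrite sub_cosetpre_quo ?subsetIl // /normal sZK.
have iKC : #|K : C| = p.
  rewrite -iC -(index_quotient_eq _ sCK nZK) ?cosetpreK //.
  by rewrite (subset_trans (subsetIr _ _)) // sub_cosetpre.
have chC : C \char K.
  have nZC : Z <| C.
    rewrite /normal (subset_trans sCK nZK) andbT.
    by rewrite sub_cosetpre.
  apply: (char_from_quotient nZC); first exact: center_char.
  by rewrite cosetpreK; apply: subcent_char (char_refl _) (der_char _ _).
(* The derived subgroup of [K / Z] has order [p ^ 2], so it is abelian and lies in its own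
   centraliser. *)
have sDC : K^`(1) \subset C.
  rewrite -sub_quotient_pre ?(subset_trans sDK) // quotient_der //.
  rewrite subsetI der_sub; apply: (@p2group_abelian _ p).
    by rewrite (pgroupS (der_sub _ _)) ?quotient_pgroup.
  by rewrite oDQ pfactorK.
have cIC : {in C, forall c, [~ x, c] \in 'C(C)}.
  move=> c Cc; have /setIP[_ cK] : [~ x, c] \in Z.
    by rewrite (subsetP sxKZ) ?imset_f ?(subsetP sCK).
  exact: (subsetP (centS sCK)).
pose I := Group (comm1_group_set _ x C cIC).
have oI : #|I| = p.
  rewrite card_comm1 (_ : 'C_C[x] = K^`(1)); last first.
    by rewrite -(setIidPl sCK) -setIA defCx; apply/setIidPr.
  have := Lagrange_index sCK sDC; rewrite iKC -(divgS sDK) oK oD.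
  rewrite -expnB // -[(6 - 4)%N]/2%N -mulnn => /eqP.
  by rewrite eqn_pmul2l // => /eqP.
have sIZ : I \subset Z.
  by apply: subset_trans sxKZ; apply: imsetS.
have nIK : K \subset 'N(I).
  by rewrite cents_norm // centsC (subset_trans sIZ) ?subsetIr.
suffices defM : [~: 'Z_2(K), C] = I.
  by exists [~: 'Z_2(K), C]%G; rewrite /= ?defM // -defM charR ?ucn_char.
apply/eqP; rewrite eqEsubset; apply/andP; split; last first.
  by apply/subsetP => _ /imsetP[c Cc ->]; apply: mem_commg.
(* It is enough that ['Z_2(K)] and [C] commute modulo [I], which need only be checked on [Z] and on
   [x]. *)
rewrite -quotient_cents2 ?(subset_trans _ nIK) //.
rewrite -(joing_cycle_prime_index _ _ _ _ sZZ2 _ Z2x notZx) ?i2 //.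
rewrite quotientY ?(subset_trans _ nIK) ?cycle_subG // join_subG.
apply/andP; split.
  by rewrite quotient_cents // (subset_trans (subsetIr _ _)) ?centS.
rewrite quotient_cycle ?(subsetP nIK) // cycle_subG.
apply/centP => _ /morphimP[c nIc Cc ->]; apply/commgP.
have Ixc : [~ x, c] \in I by apply: imset_f.
rewrite -morphR ?(subsetP nIK x Kx) //; apply/eqP; exact: (coset_id Ixc).
Qed.

(** * Restriction of the given character to the normal Sylow subgroup *)

(** Here [f] is a multiplicity, [t] an orbit length and [d] a degree. As a power of [p], [d] is
    coprime to [(p ^ 2).-1] and so divides [p ^ 2]; hence [(p ^ 2).-1 <= f * t], and the bound on
    [f * f * t] leaves only [f = 1]. *)
Lemma isaacs_degree_arith (p f t d : nat) :
  prime p -> 0 < f -> d %| p ^ 6 -> (f * t * d)%N = (p ^ 2 * (p ^ 2).-1)%N ->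
  f * f * t <= (p ^ 2).-1 -> t = (p ^ 2).-1 /\ d = (p ^ 2)%N.
Proof.
move=> p_pr f_gt0 dv eqd le_f; have p_gt1 := prime_gt1 p_pr.
have p2_gt1 : 1 < p ^ 2 by rewrite (ltn_exp2l 0%N 2%N).
have q_gt0 : 0 < (p ^ 2).-1 by rewrite -subn1 subn_gt0.
have p2_gt0 := ltnW p2_gt1.
have dvp2 : d %| p ^ 2.
  have [k _ dk] := dvdn_pfactor _ _ p_pr dv.
  have cop : coprime d (p ^ 2).-1.
    rewrite dk coprimeXl //.
    have := coprimenP p2_gt0; rewrite coprime_sym.
    by move/(coprime_dvdr (dvdn_exp _ (dvdnn p))) => /(_ isT); rewrite coprime_sym.
  by rewrite -(Gauss_dvdl _ cop) -eqd dvdn_mull.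
have led : d <= p ^ 2 by apply: dvdn_leq.
have le_q : (p ^ 2).-1 <= f * t.
  by rewrite -(leq_pmul2l p2_gt0) -eqd mulnC leq_mul2r led orbT.
have f1 : f = 1%N.
  apply/eqP; rewrite eqn_leq f_gt0 andbT -(leq_pmul2r (leq_trans q_gt0 le_q)).
  by rewrite mul1n mulnA (leq_trans le_f).
rewrite f1 !mul1n in eqd le_q le_f.
have t_q : t = (p ^ 2).-1 by apply/eqP; rewrite eqn_leq le_f.
split=> //; apply/eqP; rewrite -(eqn_pmul2l q_gt0) -{1}t_q eqd.
by rewrite mulnC.
Qed.

Section Characters.

Import Order.TTheory GRing.Theory Num.Theory.
Local Open Scope ring_scope.

Lemma cfnorm_sum_cfclass (gT : finGroupType) (G K : {group gT}) (j : Iirr K) :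
  K <| G ->
  '[\sum_(chi <- ('chi_j ^: G)%CF) chi]_K = #|cfclass_Iirr G j|%:R :> algC.
Proof.
move=> nsKG; rewrite reindex_cfclass //= cfdot_suml.
rewrite (eq_bigr (fun=> 1)) => [|k jk]; last first.
  rewrite cfdot_sumr (bigD1 k) //= cfdot_irr eqxx big1 ?addr0 //.
  by move=> l /andP[_ nlk]; rewrite cfdot_irr eq_sym (negPf nlk).
by rewrite sumr_const -(eq_card (cfclass_IirrE _ _)).
Qed.

(** By Clifford the restriction is [f] times the sum over an orbit of length [t]. Its degree gives
    the product [f * t * d], and its norm [f * f * t] is at most [#|G : K|]. *)
Lemma isaacs_character_orbit (gT : finGroupType) (p : nat) (G K : {group gT})
    (i : Iirr G) :
    prime p -> K <| G -> #|K| = (p ^ 6)%N -> #|G : K| = (p ^ 2).-1 ->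
    'chi_i 1%g = (p ^ 2 * (p ^ 2).-1)%:R ->
  exists j : Iirr K,
    #|cfclass_Iirr G j| = (p ^ 2).-1 /\ 'chi_j 1%g = (p ^ 2)%:R.
Proof.
move=> p_pr nsKG oK iGK chi1; have sKG := normal_sub nsKG.
have [j jchi] := constt_cfRes_irr K i; exists j.
have [f fE] : exists f : nat, '['Res[K] 'chi_i, 'chi_j] = f%:R.
  by apply/natrP; rewrite Cnat_cfdot_char_irr ?cfRes_char ?irr_char.
have [d dE] : exists d : nat, 'chi_j 1%g = d%:R by apply/natrP/Cnat_irr1.
have f_gt0 : (0 < f)%N.
  by move: jchi; rewrite irr_consttE fE pnatr_eq0 lt0n.
have dv : (d %| p ^ 6)%N by have := dvd_irr1_cardG j; rewrite dE oK dvdC_nat.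
have ResE := Clifford_Res_sum_cfclass nsKG jchi.
pose t := #|cfclass_Iirr G j|.
have eqd : (f * t * d)%N = (p ^ 2 * (p ^ 2).-1)%N.
  apply/eqP; rewrite -(eqr_nat algC) -chi1 -(cfRes1 K) ResE fE cfunE.
  rewrite reindex_cfclass //= sum_cfunE -mulnA [in X in X == _]natrM.
  apply/eqP; congr (_ * _).
  rewrite (eq_bigr (fun=> d%:R)); last first.
    by move=> k /cfclassP[y _ ->]; rewrite cfConjg1.
  by rewrite sumr_const -(eq_card (cfclass_IirrE _ _)) natrM mulr_natl.
have le_f : (f * f * t <= (p ^ 2).-1)%N.
  rewrite -iGK -(ler_nat algC).
  have := cfnorm_Res_leif 'chi_i sKG; rewrite cfnorm_irr mulr1 => -[+ _].
  by rewrite ResE cfnormZ cfnorm_sum_cfclass // fE normr_nat !natrM expr2.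
have [tE dE'] := isaacs_degree_arith _ _ _ _ p_pr f_gt0 dv eqd le_f.
by rewrite dE dE'.
Qed.

(** The characters summed over are those inflated from [K / M]. *)
Lemma sum_irr1_quo (gT : finGroupType) (K M : {group gT}) : M <| K ->
  \sum_(k | M \subset cfker 'chi[K]_k) 'chi_k 1%g ^+ 2 = #|K : M|%:R.
Proof.
move=> nsMK; rewrite -card_quotient ?normal_norm // -irr_sum_square.
have := sum_norm_irr_quo (group1 K) nsMK.
rewrite (eq_bigr (fun k => 'chi_k 1%g ^+ 2)) => [sumE | k _]; last first.
  by rewrite morph1 ger0_norm // char1_ge0 ?irr_char.
rewrite sumE; apply: eq_bigr => k _.
by rewrite ger0_norm // char1_ge0 ?irr_char.
Qed.

Lemma cfker_cfclass (gT : finGroupType) (G K M : {group gT}) (j k l : Iirr K) :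
  M <| G -> k \in cfclass_Iirr G j -> l \in cfclass_Iirr G j ->
  M \subset cfker 'chi_k -> M \subset cfker 'chi_l.
Proof.
move=> /andP[_ nMG]; suffices orb k' : k' \in cfclass_Iirr G j ->
    (M \subset cfker 'chi_k') = (M \subset cfker 'chi_j).
  by move=> /orb-> /orb->.
(* Conjugation by an element outside ['N(K)] is trivial by convention, so the orbit is already that
   of ['N_G(K)], whose elements conjugate kernels as expected. *)
rewrite cfclass_IirrE -cfclassInorm => /cfclassP[y /setIP[Gy nKy] ->].
by rewrite cfker_conjg // -{1}(normP (subsetP nMG y Gy)) conjSg.
Qed.

(** * Counting squared degrees along the orbit, and the resulting commutator condition *)

Section Orbit.

Variables (gT : finGroupType) (p : nat) (G K : {group gT}) (j : Iirr K).
Hypotheses (p_pr : prime p) (nsKG : K <| G) (oK : #|K| = (p ^ 6)%N).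
Let O := cfclass_Iirr G j.
Hypotheses (oO : #|O| = (p ^ 2).-1) (chi1 : 'chi_j 1%g = (p ^ 2)%:R).

Let p_gt0 : (0 < p)%N := prime_gt0 p_pr.
Let p_gt1 : (1 < p)%N := prime_gt1 p_pr.

Let orbit1 k : k \in O -> 'chi_k 1%g = (p ^ 2)%:R.
Proof. by rewrite cfclass_IirrE => /cfclassP[y _ ->]; rewrite cfConjg1. Qed.

Let sum_orbit : \sum_(k in O) 'chi_k 1%g ^+ 2 = ((p ^ 2).-1 * p ^ 4)%:R.
Proof.
rewrite (eq_bigr (fun=> (p ^ 4)%:R)) => [|k /orbit1->]; last first.
  by rewrite -natrX -expnM.
by rewrite sumr_const oO -mulrnA mulnC.
Qed.

Let p6E : (p ^ 6 = (p ^ 2).-1 * p ^ 4 + p ^ 4)%N.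
Proof. by rewrite addnC -mulSn prednK ?expn_gt0 ?p_gt0 // -expnD. Qed.

Let sum_rest : \sum_(k | k \notin O) 'chi_k 1%g ^+ 2 = (p ^ 4)%:R.
Proof.
have := irr_sum_square K; rewrite (bigID (mem O)) /= sum_orbit oK p6E natrD.
exact: addrI.
Qed.

Let sq_ge0 k : 0 <= 'chi[K]_k 1%g ^+ 2.
Proof. by rewrite exprn_ge0 ?char1_ge0 ?irr_char. Qed.

(** If [M] lies in one kernel it lies in all those of the orbit, whose squared degrees then have to
    fit into [#|K : M|]. *)
Let orbit_kernel (M : {group gT}) : M <| G -> M \subset K -> M :!=: 1%g ->
  {in O, forall k, ~~ (M \subset cfker 'chi_k)}.
Proof.
move=> nsMG sMK ntM k Ok; apply: contra ntM => kerk.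
have nsMK : M <| K := normalS sMK (normal_sub nsKG) nsMG.
have: ((p ^ 2).-1 * p ^ 4 <= #|K : M|)%N.
  rewrite -(ler_nat algC) -sum_orbit -sum_irr1_quo //.
  rewrite [leRHS](bigID (mem O)) /= -[leLHS]addr0 lerD ?sumr_ge0 //.
  rewrite le_eqVlt; apply/orP; left; apply/eqP/eq_bigl => l.
  rewrite andb_idl // => Ol.
  exact: cfker_cfclass nsMG Ok Ol kerk.
have: (#|K : M| %| p ^ 6)%N by rewrite -oK dvdn_indexg.
case/(dvdn_pfactor _ _ p_pr) => m m6 iM.
(* This amounts to [p + 1 < p ^ 2]; the index, a power of [p] above [p ^ 5], must then be
   [p ^ 6]. *)
have lt_p : (p ^ 5 < (p ^ 2).-1 * p ^ 4)%N.
  rewrite (expnD p 1 4) ltn_pmul2r ?expn_gt0 ?p_gt0 //.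
  rewrite -ltnS prednK ?expn_gt0 ?p_gt0 // expn1.
  apply: (@leq_trans (2 * p)%N); last by rewrite expnS expn1 leq_mul2r p_gt1 orbT.
  by rewrite mul2n -addnn -[p.+2]addn2 leq_add2l.
rewrite iM => /(leq_trans lt_p); rewrite ltn_exp2l // => m_gt5.
have m_eq : m = 6%N by apply/eqP; rewrite eqn_leq m6.
have := Lagrange sMK; rewrite iM oK m_eq => /eqP.
by rewrite -[X in _ == X]mul1n eqn_pmul2r ?expn_gt0 ?p_gt0 // -trivg_card1.
Qed.

(** Characters with [M] in their kernel lie outside the orbit, where the squared degrees total
    [p ^ 4]. *)
Lemma leq_index_normal (M : {group gT}) :
  M <| G -> M \subset K -> M :!=: 1%g -> (#|K : M| <= p ^ 4)%N.
Proof.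
move=> nsMG sMK ntM.
have nsMK : M <| K := normalS sMK (normal_sub nsKG) nsMG.
rewrite -(ler_nat algC) -sum_rest -sum_irr1_quo //.
rewrite [leRHS](bigID (fun k => M \subset cfker 'chi_k)) /=.
rewrite -[leLHS]addr0 lerD ?sumr_ge0 //.
rewrite le_eqVlt; apply/orP; left; apply/eqP/eq_bigl => k.
by rewrite andb_idl // => kerk; apply/negP => /(orbit_kernel _ nsMG sMK ntM)/negP.
Qed.

Let orbit_refl : j \in O.
Proof. by rewrite cfclass_IirrE cfclass_refl. Qed.

Let sZC k : 'Z(K) \subset 'Z('chi[K]_k)%CF.
Proof. by rewrite -cap_cfcenter_irr bigcap_inf. Qed.

Let pK : p.-group K. Proof. by rewrite /pgroup oK pnatX pnat_id. Qed.

Let ntZ : 'Z(K) != 1%g.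
Proof.
rewrite (center_nil_eq1 (pgroup_nil pK)) trivg_card1 oK -[1%N](expn0 p).
by rewrite eqn_exp2l.
Qed.

Let nsZG : 'Z(K) <| G. Proof. exact: char_normal_trans (center_char K) nsKG. Qed.

Let le_iC k : k \in O -> (p ^ 4 <= #|K : 'Z('chi_k)%CF|)%N.
Proof.
move=> Ok; rewrite -(ler_nat algC) (expnM p 2 2) natrX -(orbit1 k Ok).
exact: irr1_bound.
Qed.

(** The upper bound takes [M] to be ['Z(K)]; the lower one is the degree bound for ['Z('chi_j)],
    which contains ['Z(K)]. *)
Lemma index_center_orbit : #|K : 'Z(K)| = (p ^ 4)%N.
Proof.
apply/eqP; rewrite eqn_leq leq_index_normal ?center_sub //=.
apply: leq_trans (le_iC j orbit_refl) _.
exact: dvdn_leq (indexg_gt0 _ _) (indexgS _ (sZC j)).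
Qed.

(** Equality in the degree bound forces vanishing off ['Z('chi_k)], which by its index is
    ['Z(K)]. *)
Let orbit_vanish k x : k \in O -> x \notin 'Z(K) -> 'chi_k x = 0.
Proof.
move=> Ok notZx.
have iC : #|K : 'Z('chi_k)%CF| = (p ^ 4)%N.
  apply/eqP; rewrite eqn_leq le_iC // andbT -index_center_orbit.
  exact: dvdn_leq (indexg_gt0 _ _) (indexgS _ (sZC k)).
have defC : 'Z('chi_k)%CF = 'Z(K).
  apply/esym/eqP; rewrite eqEcard sZC /=.
  rewrite -(leq_pmul2r (indexg_gt0 K 'Z(K))) Lagrange ?center_sub //.
  by rewrite index_center_orbit -iC Lagrange // cfcenter_sub.
have [_] := irr1_bound k; rewrite orbit1 // iC -natrX -expnM eqxx defC.
by move/esym/cfun_on0; apply.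
Qed.

(** Characters of [K / 'Z(K)] already exhaust the sum [p ^ 4], so any other one outside the orbit
    would have degree zero. *)
Let rest_kernel k : k \notin O -> 'Z(K) \subset cfker 'chi_k.
Proof.
move=> notOk; apply/negPn/negP => notker.
have := sum_rest; rewrite (bigID (fun l => 'Z(K) \subset cfker 'chi_l)) /=.
rewrite (eq_bigl (fun l => 'Z(K) \subset cfker 'chi_l)) => [|l]; last first.
  rewrite andb_idl // => kerl.
  by apply/negP => /(orbit_kernel _ nsZG (center_sub K) ntZ)/negP.
rewrite sum_irr1_quo ?center_normal // index_center_orbit.
rewrite -[RHS]addr0 => /addrI/eqP; rewrite psumr_eq0 // => /allP/(_ k).
by rewrite mem_index_enum notOk notker expf_eq0 /= (negPf (irr1_neq0 k)) => /(_ isT).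
Qed.

Lemma orbit_camina :
  {in K :\: 'Z(K), forall x, 'Z(K) \subset [set [~ x, k] | k in K]}.
Proof.
move=> x /setDP[Kx notZx]; apply/subsetP => z Zz.
have Kz : z \in K := subsetP (center_sub K) z Zz.
suffices /imsetP[k Kk xzE] : (x * z)%g \in x ^: K.
  by apply/imsetP; exists k; rewrite // commgEl -xzE mulKg.
have eqchi k : 'chi[K]_k (x * z)%g = 'chi_k x.
  have [Ok | notOk] := boolP (k \in O).
    by rewrite !orbit_vanish ?groupMr.
  by rewrite cfkerMr // (subsetP (rest_kernel k notOk)).
(* All irreducible characters agree at [x * z] and [x]. Were these not conjugate, the column sum
   would be 0 instead of the order of the centraliser of [x]. *)
have := second_orthogonality_relation (x * z)%g Kx.
rewrite (eq_bigr (fun k => 'chi_k x * ('chi_k x)^*)) => [|k _]; last by rewrite eqchi.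
rewrite second_orthogonality_relation // class_refl.
case: ((x * z)%g \in x ^: K) => //.
by move/eqP; rewrite mulr1n mulr0n pnatr_eq0 gtn_eqF ?cardG_gt0.
Qed.

End Orbit.

End Characters.

(** * From the commutator condition to the structure of [K] *)

(** If [x] outside ['Z(K)] became central modulo [M], all [[~ x, k]] would lie in [M], and so would
    ['Z(K)]. Hence [K / M] has centre ['Z(K) / M], of order [p]. *)
Lemma camina_semi_extraspecial (gT : finGroupType) (p : nat) (K : {group gT}) :
    prime p -> p.-group K -> K^`(1) = 'Z(K) ->
    {in K :\: 'Z(K), forall x, 'Z(K) \subset [set [~ x, k] | k in K]} ->
  semi_extraspecial p K.
Proof.
move=> p_pr pK defK' camK; split=> // M maxM.
have [sZK pZ] := (center_sub K, pgroupS (center_sub K) pK).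
have /andP[sMZ notsZM] := maxgroupp maxM.
have nMK : K \subset 'N(M).
  by rewrite cents_norm // centsC (subset_trans sMZ) ?subsetIr.
have defZ : 'Z(K / M) = 'Z(K) / M.
  apply/eqP; rewrite eqEsubset; apply/andP; split; last first.
    by rewrite subsetI quotientS // quotient_cents ?subsetIr.
  apply/subsetP => _ /setIP[/morphimP[x nMx Kx ->] cKx].
  rewrite mem_morphim //; apply: contraR notsZM => notZx.
  have /subset_trans-> // : 'Z(K) \subset [set [~ x, k] | k in K].
    by rewrite camK // inE notZx.
  apply/subsetP => _ /imsetP[k Kk ->]; have nMk := subsetP nMK k Kk.
  rewrite coset_idr ?groupR // morphR //; apply/eqP/commgP.
  by apply: (centP cKx); apply: mem_quotient.
have oZM : #|'Z(K / M)| = p.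
  rewrite defZ card_quotient ?(subset_trans sZK) //.
  exact: p_maximal_index pZ maxM.
split; last by rewrite oZM.
apply: (pgroup_special _ p); rewrite ?quotient_pgroup ?prime_abelem //.
by rewrite defZ -defK' quotient_der.
Qed.

(** Unless trivial, ['Ohm_1('Z(K))] is a normal subgroup of [G] to which minimality applies. *)
Lemma minnormal_center_abelem (gT : finGroupType) (p : nat) (G K : {group gT}) :
    p.-group K -> K <| G ->
    (forall M : {group gT}, M <| G -> M \subset K -> M :!=: 1 ->
      #|'Z(K)| <= #|M|) ->
  p.-abelem 'Z(K).
Proof.
move=> pK nsKG minZ; have pZ := pgroupS (center_sub K) pK.
have [-> | ntZ] := eqVneq 'Z(K) 1; first exact: abelem1.
have sOZ := Ohm_sub 1 'Z(K).
have abO := Ohm1_abelem pZ (center_abelian K).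
suffices <- : 'Ohm_1('Z(K)) = 'Z(K) by [].
apply/eqP; rewrite eqEcard sOZ minZ ?(subset_trans sOZ) ?center_sub //=.
  exact: char_normal_trans (char_trans (Ohm_char 1 _) (center_char K)) nsKG.
by rewrite Ohm1_eq1.
Qed.

Theorem theorem5p1 (gT : finGroupType) (G : {group gT}) (p : nat) :
  prime p ->
  isaacs_group (p ^ 2)%N G ->
  p_closed p G ->
  forall K : {group gT}, p.-Sylow(G) K -> K <| G ->
  [/\ p.-group K,
      #|K| = (p ^ 6)%N,
      p.-abelem 'Z(K),
      #|'Z(K)| = (p ^ 2)%N
    & (K^`(1) = 'Z(K) /\ semi_extraspecial p K)
      \/ [/\ 'Z(K) = [~: K^`(1), K],
             [~: K^`(1), K] \proper K^`(1),
             K^`(1) \proper 'Z_2(K),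
             #|'Z_2(K)| = (p ^ 4)%N
           & #|K^`(1)| = (p ^ 3)%N]].
Proof.
move=> p_pr [_ oG [i chi1]] _ K sylK nsKG.
have [p_gt0 p_gt1] := (prime_gt0 p_pr, prime_gt1 p_pr).
have [sKG pK _] := and3P sylK.
have p2_gt0 : 0 < p ^ 2 by rewrite expn_gt0 p_gt0.
have {}oG : #|G| = (p ^ 6 * (p ^ 2).-1)%N.
  by rewrite oG -!expnM -subn1 mulnBr muln1 -expnD.
have oK : #|K| = (p ^ 6)%N.
  have q_gt0 : 0 < (p ^ 2).-1.
    by move: (cardG_gt0 G); rewrite oG muln_gt0 => /andP[].
  rewrite (card_Hall sylK) oG partnM ?expn_gt0 ?p_gt0 //.
  rewrite part_pnat_id ?pnatX ?pnat_id //.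
  rewrite part_p'nat ?muln1 // p'natE //.
  apply/negP => dv; have : p %| 1.
    by rewrite -(@dvdn_addr (p ^ 2).-1) // addn1 prednK // dvdn_exp.
  by rewrite dvdn1 => /eqP p1; rewrite p1 in p_gt1.
have iGK : #|G : K| = (p ^ 2).-1.
  by rewrite -divgS // oK oG mulKn // expn_gt0 p_gt0.
have {}chi1 : ('chi_i 1%g = (p ^ 2 * (p ^ 2).-1)%N%:R)%R.
  by rewrite chi1 -subn1 mulnBr muln1 mulnn.
have [j [oO chij1]] := isaacs_character_orbit _ _ _ _ _ p_pr nsKG oK iGK chi1.
have iZ := index_center_orbit _ _ _ _ _ p_pr nsKG oK oO chij1.
have camK := orbit_camina _ _ _ _ _ p_pr nsKG oK oO chij1.
have sZK := center_sub K; have nZK : K \subset 'N('Z(K)) by apply: gFnorm.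
have oZ : #|'Z(K)| = (p ^ 2)%N.
  have := Lagrange sZK; rewrite iZ oK (expnD p 2 4) => /eqP.
  by rewrite eqn_pmul2r ?expn_gt0 ?p_gt0 // => /eqP.
have minZ (M : {group gT}) :
    M <| G -> M \subset K -> M :!=: 1 -> #|'Z(K)| <= #|M|.
  move=> nsMG sMK ntM.
  have := leq_index_normal _ _ _ _ _ p_pr nsKG oK oO chij1 M nsMG sMK ntM.
  rewrite oZ -(leq_pmul2l (cardG_gt0 M)) Lagrange // oK (expnD p 2 4).
  by rewrite leq_pmul2r // expn_gt0 p_gt0.
have abZ := minnormal_center_abelem _ _ _ _ pK nsKG minZ.
split=> //; have [defK' | neqK'Z] := eqVneq K^`(1) 'Z(K).
  by left; split=> //; apply: camina_semi_extraspecial.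
right.
have oQ : #|K / 'Z(K)| = (p ^ 4)%N by rewrite card_quotient.
have [x Kx notZx] : exists2 x, x \in K & x \notin 'Z(K).
  apply/subsetPn; apply/negP => /subset_leq_card.
  by rewrite oK oZ leq_exp2l.
have sZxK y : y \in K -> y \notin 'Z(K) -> 'Z(K) \subset [set [~ y, k] | k in K].
  by move=> Ky notZy; rewrite camK // inE notZy.
have sZK' : 'Z(K) \subset K^`(1).
  apply: subset_trans (sZxK x Kx notZx) _.
  by apply/subsetP => _ /imsetP[k Kk ->]; apply: mem_commg.
have sK'K := der_sub 1 K.
have notsK'Z : ~~ (K^`(1) \subset 'Z(K)).
  by apply: contra neqK'Z => sK'Z; rewrite eqEsubset sK'Z.
have ncQ : ~~ abelian (K / 'Z(K)).
  by apply: contra notsK'Z => cQ; apply: der1_min.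
(* Maximal class is excluded: a characteristic subgroup of order [p] is normal in [G] and smaller
   than ['Z(K)]. *)
case: (p4group_nonabelian _ _ _ p_pr oQ ncQ) => [[oZQ oQ'] | [oZQ oQ' iC]]; last first.
  have [M chM oM] := camina_max_class_char _ _ _ p_pr pK oZ iZ camK oZQ oQ' iC.
  have := minZ M (char_normal_trans chM nsKG) (char_sub chM).
  rewrite oZ oM leqNgt (ltn_exp2l 1%N 2%N) // => /(_ _)/negP[] //.
  by rewrite trivg_card1 oM gtn_eqF.
have oK' : #|K^`(1)| = (p ^ 3)%N.
  rewrite -(Lagrange sZK') oZ -card_quotient ?(subset_trans sK'K) //.
  by rewrite quotient_der // oQ' -expnSr.
have oZ2 : #|'Z_2(K)| = (p ^ 4)%N by rewrite card_ucn2 oZ oZQ -expnD.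
(* The derived subgroup of [K / 'Z(K)] has order [p] and meets the centre of that quotient, hence
   lies in it. *)
have sK'Z2 : K^`(1) \subset 'Z_2(K).
  rewrite ucnSn ucn1 -sub_quotient_pre ?(subset_trans sK'K) // quotient_der //.
  rewrite prime_meetG ?oQ' // meet_center_nil ?der_normal //.
    by rewrite (pgroup_nil (quotient_pgroup _ pK)).
  by apply: contra ncQ => /eqP/derG1P.
have defR : [~: K^`(1), K] = 'Z(K).
  apply/eqP; rewrite eqEsubset; apply/andP; split.
    by rewrite (subset_trans (commSg _ sK'Z2)) // (subset_trans (ucn_comm 1 K)) ?ucn1.
  (* For the reverse inclusion, the commutators of a single noncentral [y] in the derived subgroup
     already cover ['Z(K)]. *)
  have [y K'y notZy] := subsetPn notsK'Z.
  apply: subset_trans (sZxK y (subsetP sK'K y K'y) notZy) _.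
  by apply/subsetP => _ /imsetP[k Kk ->]; apply: mem_commg.
split=> //; rewrite properEcard ?defR ?sZK' ?sK'Z2 /= ?oZ2 ?oK' ?oZ.
  by rewrite ltn_exp2l.
by rewrite ltn_exp2l.
Qed.
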